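(* Let $\Phi\in\mathcal B_0$ satisfy the following: (a) $\int_{\mathbb R^d}e^{-t\Phi(|\xi|^2)}\,d\xi<\infty$ for every $t>0$; (b) there exist constants $c>0$ and $s\in(0,1)$ such that $j_\Phi(r)\ge c\,r^{-d-2s}$ for all $r\in(0,1]$. Then there exists a constant $C=C(d,s)>0$, dependent on $d$ and $s$, such that for every $u\in H^\Phi(\mathbb R^d)$, $$\|u\|_{2}+[[u]]_s\le C\big(\|u\|_2+[u]_\Phi\big),$$ i.e. $H^\Phi(\mathbb R^d)$ is continuously embedded in $H^s(\mathbb R^d)$.
   Context: Fix $d\in\mathbb N$; $\|\cdot\|_2$ is the norm of $L^2(\mathbb R^d)$. A Bernstein function is a $\Phi\in C^\infty((0,\infty))$ with $\Phi\ge0$ and $(-1)^n\Phi^{(n)}\le0$ for all $n\ge1$. It has a unique representation $\Phi(z)=a_\Phi+b_\Phi z+\int_0^\infty(1-e^{-zt})\mu_\Phi(dt)$ with $a_\Phi,b_\Phi\ge0$ and $\int_{(0,\infty)}(1\wedge t)\mu_\Phi(dt)<\infty$. It is complete if $\mu_\Phi(dt)=m_\Phi(t)dt$ with $m_\Phi$ completely monotone. $\mathcal B_0$ is the set of complete Bernstein functions with $a_\Phi=b_\Phi=0$. The jump kernel is $j_\Phi(r)=\int_0^\infty(4\pi t)^{-d/2}e^{-r^2/(4t)}m_\Phi(t)\,dt$, $r>0$. $H^\Phi(\mathbb R^d)$ is the set of real-valued $u\in L^2(\mathbb R^d)$ with $\sqrt{\Phi(|\cdot|^2)}\,\widehat u\in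 L^2$, where $\widehat u$ is the Fourier transform of $u$; equivalently $u\in L^2(\mathbb R^d)$ and $[u]_\Phi^2=\frac12\int_{\mathbb R^d}\int_{\mathbb R^d}|u(x+h)-u(x)|^2j_\Phi(|h|)\,dx\,dh<\infty$. It is normed by $\|u\|_\Phi=\|u\|_2+[u]_\Phi$. $[[u]]_s^2=\int_{\mathbb R^d}\int_{\mathbb R^d}\frac{|u(x+y)-u(x)|^2}{|y|^{d+2s}}\,dy\,dx$, and $H^s(\mathbb R^d)=\{u\in L^2(\mathbb R^d):[[u]]_s<\infty\}$ with norm $\|u\|_2+[[u]]_s$.
   Formalization: The constant C is allowed to depend on c from hypothesis (b) as well as on d and s (uniformly in Φ and u); a constant depending on d and s only is impossible, as Φ(z)=εz^s with ε→0 shows. *)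

(* Defs.v *)
From HB Require Import structures.
From mathcomp Require Import all_boot all_order all_algebra.
From mathcomp Require Import all_classical all_reals all_analysis.

Set Implicit Arguments.
Unset Strict Implicit.
Unset Printing Implicit Defensive.
Import Order.TTheory GRing.Theory Num.Theory.
Import numFieldNormedType.Exports.

Local Open Scope classical_set_scope.
Local Open Scope ring_scope.

(* R^d is the type of d-tuples of reals, with the product of the Borel
   sigma-algebras. The library has no Lebesgue measure on tuples: it is built
   by recursion on d, transporting the binary product measure along
   (x0, x) |-> x0 :: x. *)
Notation Rd R d := (d.-tuple (measurableTypeR R)).

Section cons_measure.
Context (disp : measure_display) (T : measurableType disp) (R : realType).
Context (n : nat).

Definition cons_pair (p : T * n.-tuple T) : n.+1.-tuple T :=
  [the n.+1.-tuple T of p.1 :: p.2].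

Definition uncons_pair (x : n.+1.-tuple T) : T * n.-tuple T :=
  (thead x, [tuple of behead x]).

Lemma measurable_cons_pair : measurable_fun [set: T * n.-tuple T] cons_pair.
Proof. exact: measurable_cons. Qed.

Lemma measurable_uncons_pair :
  measurable_fun [set: n.+1.-tuple T] uncons_pair.
Proof.
apply/measurable_fun_pairP; split; first exact: measurable_tnth.
exact: measurable_behead.
Qed.

Lemma cons_pairK : cancel cons_pair uncons_pair.
Proof.
move=> [a x]; rewrite /uncons_pair /cons_pair theadE.
by congr pair; apply/val_inj.
Qed.

Variables (m1 : {sigma_finite_measure set T -> \bar R})
  (m2 : {sigma_finite_measure set (n.-tuple T) -> \bar R}).

Definition cons_measure : set (n.+1.-tuple T) -> \bar R :=
  pushforward (m1 \x m2)%E cons_pair.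

Let measurable_preimage_cons_pair (A : set (n.+1.-tuple T)) :
  measurable A -> measurable (cons_pair @^-1` A).
Proof.
by move=> mA; rewrite -[X in measurable X]setTI; exact: measurable_cons_pair.
Qed.

Let cons_measure0 : cons_measure set0 = 0%E.
Proof. by rewrite /cons_measure /pushforward preimage_set0 measure0. Qed.

Let cons_measure_ge0 A : (0 <= cons_measure A)%E.
Proof. by rewrite /cons_measure /pushforward. Qed.

Let cons_measure_sigma_additive : semi_sigma_additive cons_measure.
Proof.
move=> F mF tF mUF; rewrite /cons_measure /pushforward preimage_bigcup.
apply: measure_semi_sigma_additive.
- by move=> k; exact: measurable_preimage_cons_pair.
- apply/trivIsetP => /= i j _ _ ij; rewrite -preimage_setI.
  by move/trivIsetP : tF => /(_ _ _ _ _ ij) ->//; rewrite preimage_set0.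
- by rewrite -preimage_bigcup; exact: measurable_preimage_cons_pair.
Qed.

HB.instance Definition _ := isMeasure.Build _ _ _ cons_measure
  cons_measure0 cons_measure_ge0 cons_measure_sigma_additive.

Let cons_measure_sigma_finite : sigma_finite setT cons_measure.
Proof.
have /sigma_finiteP[F [TF ndF Foo]] := sigma_finiteT m1.
have /sigma_finiteP[G [TG ndG Goo]] := sigma_finiteT m2.
exists (fun k => uncons_pair @^-1` (F k `*` G k)).
  rewrite -preimage_bigcup [X in _ @^-1` X](_ : _ = setT)// predeqE => -[x y].
  split=> // _.
  have [i _ Fix] : (\bigcup_k F k) x by rewrite -TF.
  have [j _ Gjy] : (\bigcup_k G k) y by rewrite -TG.
  exists (maxn i j) => //; split.
  - by move: x Fix; exact/subsetPset/ndF/leq_maxl.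
  - by move: y Gjy; exact/subsetPset/ndG/leq_maxr.
move=> k; have [mF Fk] := Foo k; have [mG Gk] := Goo k.
have mFG : measurable (F k `*` G k) by exact: measurableX.
split.
  by rewrite -[X in measurable X]setTI; exact: measurable_uncons_pair.
rewrite /cons_measure /pushforward -comp_preimage.
rewrite [X in _ ((X @^-1` _))](_ : _ = id); last first.
  by apply/funext => x /=; rewrite cons_pairK.
by rewrite preimage_id product_measure1E// lte_mul_pinfty// ge0_fin_numE.
Qed.

HB.instance Definition _ := Measure_isSigmaFinite.Build _ _ _ cons_measure
  cons_measure_sigma_finite.

End cons_measure.

Fixpoint lebesgueRd (R : realType) (d : nat) :
    {sigma_finite_measure set (Rd R d) -> \bar R} :=
  match d with
  | 0 => \d_([tuple] : Rd R 0)
  | d'.+1 => cons_measure (@lebesgue_measure R) (lebesgueRd R d')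
  end.

Definition addRd (R : realType) (d : nat) (x y : Rd R d) : Rd R d :=
  [tuple tnth x i + tnth y i | i < d].

Definition enorm (R : realType) (d : nat) (x : Rd R d) : R :=
  Num.sqrt (\sum_(i < d) tnth x i ^+ 2).

(* Functions on (0,+oo) are represented by total functions R -> R whose values
   on (-oo,0] are irrelevant. *)
Definition smooth_pos (R : realType) (f : R -> R) : Prop :=
  forall (n : nat) (z : R), 0 < z -> derivable (derive1n n f) z 1.

Definition bernstein (R : realType) (Phi : R -> R) : Prop :=
  [/\ smooth_pos Phi,
      forall z : R, 0 < z -> 0 <= Phi z &
      forall (n : nat) (z : R), (1 <= n)%N -> 0 < z ->
        (-1) ^+ n * derive1n n Phi z <= 0].

Definition completely_monotone (R : realType) (m : R -> R) : Prop :=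
  smooth_pos m /\
  forall (n : nat) (t : R), 0 < t -> 0 <= (-1) ^+ n * derive1n n m t.

Definition levy_khintchine (R : realType) (Phi : R -> R) (a b : R)
    (mu : {measure set (measurableTypeR R) -> \bar R}) : Prop :=
  [/\ 0 <= a, 0 <= b,
      (\int[mu]_(t in `]0%R, +oo[) (Num.min 1 t)%:E < +oo)%E &
      forall z : R, 0 < z ->
        (Phi z)%:E = ((a + b * z)%:E +
          \int[mu]_(t in `]0%R, +oo[) (1 - expR (- (z * t)))%:E)%E].

Definition has_density_pos (R : realType)
    (mu : {measure set (measurableTypeR R) -> \bar R}) (m : R -> R) : Prop :=
  forall A : set (measurableTypeR R), measurable A -> A `<=` `]0, +oo[ ->
    mu A = (\int[lebesgue_measure]_(t in A) (m t)%:E)%E.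

(* Phi is a complete Bernstein function with drift coefficients a and b and
   Levy density m. On (0,+oo), m is determined by Phi: the Levy measure is, and
   m is continuous. *)
Definition complete_bernstein (R : realType) (Phi : R -> R) (a b : R)
    (m : R -> R) : Prop :=
  bernstein Phi /\
  exists mu : {measure set (measurableTypeR R) -> \bar R},
    [/\ levy_khintchine Phi a b mu, has_density_pos mu m &
        completely_monotone m].

Definition complete_bernstein0 (R : realType) (Phi m : R -> R) : Prop :=
  complete_bernstein Phi 0 0 m.

Definition jump_kernel (R : realType) (d : nat) (m : R -> R) (r : R) : \bar R :=
  (\int[lebesgue_measure]_(t in `]0%R, +oo[)
    ((4 * pi * t) `^ (- (d%:R / 2)) * expR (- (r ^+ 2 / (4 * t))) * m t)%:E)%E.

Definition L2norm (R : realType) (d : nat) (u : Rd R d -> R) : \bar R :=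
  ('N[lebesgueRd R d]_2%:E[EFin \o u])%E.

Definition seminorm_Phi (R : realType) (d : nat) (m : R -> R)
    (u : Rd R d -> R) : \bar R :=
  sqrte ((2^-1)%:E *
    \int[lebesgueRd R d]_h \int[lebesgueRd R d]_x
      ((`|u (addRd x h) - u x| ^+ 2)%:E * jump_kernel d m (enorm h)))%E.

Definition seminorm_s (R : realType) (d : nat) (s : R)
    (u : Rd R d -> R) : \bar R :=
  sqrte (\int[lebesgueRd R d]_x \int[lebesgueRd R d]_y
      (`|u (addRd x y) - u x| ^+ 2 / enorm y `^ (d%:R + 2 * s))%:E)%E.

(* Elements of L^2 are represented by Borel functions; the norms and seminorms
   are invariant under equality almost everywhere. H^Phi is taken in its
   difference form, through the seminorm that also defines its norm. *)
Definition in_HPhi (R : realType) (d : nat) (m : R -> R)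
    (u : Rd R d -> R) : Prop :=
  u \in Lfun (lebesgueRd R d) 2%:E /\ (seminorm_Phi m u < +oo)%E.

Definition in_Hs (R : realType) (d : nat) (s : R) (u : Rd R d -> R) : Prop :=
  u \in Lfun (lebesgueRd R d) 2%:E /\ (seminorm_s s u < +oo)%E.

(* Main.v *)
Require Import Defs.
From HB Require Import structures.
From mathcomp Require Import all_boot all_order all_algebra.
From mathcomp Require Import all_classical all_reals all_analysis measurable_realfun.
From mathcomp Require Import ring lra.
Import Order.TTheory GRing.Theory Num.Theory.
Import numFieldNormedType.Exports.
Local Open Scope classical_set_scope.
Local Open Scope ring_scope.

(** The Gagliardo double integral is split according to the length of the
    increment y. Tonelli's theorem first puts the integral over y outside.

    - Where |y| <= 1, the lower bound on the jump kernel replaces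
      |y|^(-d-2s) by j(|y|) / c, so this part is at most
      (2 / c) times the square of the Phi-seminorm.
    - Where |y| > 1, no smoothness of u is used: translation invariance of
      Lebesgue measure (ge0_integral_addRd) bounds the squared L^2 norm of
      u(. + y) - u by 4 times that of u, and |y|^(-d-2s) is integrable at
      infinity (integral_enorm_tail_lty).

    The resulting estimate is gagliardo_le; taking square roots and using their
    subadditivity gives the constant
    C = 1 + sqrt (2 / c) + sqrt (4 K), with K the tail integral.

    Both facts about Lebesgue measure on R^d are proved by induction on d from
    the real line, along the identification of R^(d+1) with R x R^d. In
    particular the tail is computed without polar coordinates: for |y| > 1 every
    1 + |y_i| is at most 2 |y|, so that |y|^(-d p) is dominated by a constant
    times the product of the (1 + |y_i|)^(-p), whose integral is the d-th power
    of a convergent one-dimensional integral as soon as p > 1. *)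

(** * Integrals over the line and over R^d *)

(** Lebesgue measure is determined by its values on half-open intervals, whose
    lengths a shift does not change. *)
Lemma lebesgue_measure_shift (R : realType) (a : R)
    (A : set (measurableTypeR R)) : measurable A ->
  pushforward lebesgue_measure (fun x : R => x + a : measurableTypeR R) A =
  lebesgue_measure A.
Proof.
move=> mA; apply/esym/lebesgue_measure_unique => //=.
  exact: measurable_funD.
move=> _ _ [[l r]] _ <-.
rewrite /pushforward /=.
rewrite (_ : _ @^-1` _ = `]l - a, r - a]%classic); last first.
  by apply/seteqP; split=> x /=; rewrite !in_itv/= ltrBlDr lerBrDr.
rewrite !lebesgue_measure_itv/= !lte_fin ltrD2r.
by case: ifP => // _; rewrite -!EFinB opprB addrA subrK.
Qed.

(** The integral of a nonnegative function is a supremum over the simple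
    functions below it, so monotonicity holds for arbitrary functions. This is
    what lets the jump kernel be used below without studying its
    measurability. *)
Lemma ge0_le_integral_pointwise d (T : measurableType d) (R : realType)
    (mu : {measure set T -> \bar R}) (f g : T -> \bar R) :
  (forall x, 0 <= f x)%E -> (forall x, f x <= g x)%E ->
  (\int[mu]_x f x <= \int[mu]_x g x)%E.
Proof.
move=> f0 fg; have g0 x : (0 <= g x)%E by apply: le_trans (fg x).
rewrite !ge0_integralTE//; apply: le_ereal_sup => _ [h hf <-]; exists h => // x.
exact: le_trans (hf x) (fg x).
Qed.

(** The step from R^n to R^(n+1) in the inductions on the dimension below. *)
Lemma ge0_integral_cons (R : realType) (n : nat) (f : Rd R n.+1 -> \bar R) :
  measurable_fun setT f -> (forall x, 0 <= f x)%E ->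
  (\int[lebesgueRd R n.+1]_x f x =
   \int[lebesgue_measure]_a \int[lebesgueRd R n]_x f (cons_pair (a, x)))%E.
Proof.
move=> mf f0 /=.
rewrite /cons_measure ge0_integral_pushforward//=; last exact: measurable_cons_pair.
rewrite preimage_setT fubini_tonelli1//=.
by apply: measurableT_comp => //; exact: measurable_cons_pair.
Qed.

Lemma ge0_integral_shift (R : realType) (a : R)
    (f : measurableTypeR R -> \bar R) :
  measurable_fun setT f -> (forall x, 0 <= f x)%E ->
  (\int[lebesgue_measure]_x f (x + a)%R = \int[lebesgue_measure]_x f x)%E.
Proof.
move=> mf f0.
pose T := measurableTypeR R; pose shift (x : T) : T := x + a.
have mshift : measurable_fun [set: T] shift by exact: measurable_funD.
transitivity (\int[pushforward (@lebesgue_measure R) shift]_x f x)%E.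
  by rewrite (ge0_integral_pushforward mshift)// preimage_setT.
by apply: eq_measure_integral => //= A mA _; exact: lebesgue_measure_shift.
Qed.

Lemma measurable_addRd (R : realType) (n : nat) :
  measurable_fun setT (fun p : Rd R n * Rd R n => addRd p.1 p.2).
Proof.
apply/measurable_fun_tnthP => i.
rewrite [X in measurable_fun _ X](_ : _ =
    (fun p : Rd R n * Rd R n => tnth p.1 i + tnth p.2 i)); last first.
  by apply/funext => p /=; rewrite tnth_mktuple.
apply: measurable_funD.
  exact: measurableT_comp (measurable_tnth i) measurable_fst.
exact: measurableT_comp (measurable_tnth i) measurable_snd.
Qed.

Lemma measurable_addRdl (R : realType) (n : nat) (h : Rd R n) :
  measurable_fun setT (fun x : Rd R n => addRd x h).
Proof.
exact: (measurableT_comp (@measurable_addRd R n) (measurable_pair2 h)).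
Qed.

Lemma addRd_cons (R : realType) (n : nat) (p : R * Rd R n) (h : Rd R n.+1) :
  addRd (cons_pair p) h =
  cons_pair (p.1 + thead h, addRd p.2 [tuple of behead h]).
Proof.
apply: eq_from_tnth => i; rewrite tnth_mktuple.
case: (unliftP ord0 i) => [j ->|->]; last by rewrite !tnth0.
rewrite /cons_pair /= !tnthS tnth_mktuple tnth_behead.
by congr (_ + tnth _ _); apply/val_inj; rewrite /= inordK// ltnS ltn_ord.
Qed.

(** A translation of R^(n+1) is a shift of the first coordinate together with a
    translation of the others, and each of the two iterated integrals absorbs its
    part. *)
Lemma ge0_integral_addRd (R : realType) (n : nat) (h : Rd R n)
    (f : Rd R n -> \bar R) :
  measurable_fun setT f -> (forall x, 0 <= f x)%E ->
  (\int[lebesgueRd R n]_x f (addRd x h) = \int[lebesgueRd R n]_x f x)%E.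
Proof.
elim: n h f => [|n IH] h f mf f0.
  by apply: eq_integral => x _; rewrite (tuple0 (addRd x h)) [in RHS](tuple0 x).
rewrite !ge0_integral_cons//; last first.
  exact: measurableT_comp mf (@measurable_addRdl _ _ _).
have mf1 : measurable_fun setT (f \o @cons_pair _ (measurableTypeR R) n).
  exact: measurableT_comp mf (@measurable_cons_pair _ _ _).
under eq_integral do under eq_integral do rewrite addRd_cons/=.
under eq_integral => a _.
  rewrite (IH _ (fun x => f (cons_pair (a + thead h, x))))//; last first.
    exact: measurableT_comp mf1 (measurable_pair1 _).
  over.
rewrite (ge0_integral_shift R (thead h)
  (fun a => \int[lebesgueRd R n]_x f (cons_pair (a, x)))%E)//.
  exact: (measurable_fun_fubini_tonelli_F (m2 := lebesgueRd R n) _ mf1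
    (fun=> f0 _)).
by move=> a; apply: integral_ge0.
Qed.

(** Tonelli for a tensor power: the variables separate one at a time. *)
Lemma integral_prod_tnth (R : realType) (n : nat) (g : R -> R) :
  measurable_fun setT g -> (forall t, 0 <= g t) ->
  (\int[lebesgueRd R n]_x (\prod_(i < n) g (tnth x i))%:E =
   (\int[lebesgue_measure]_t (g t)%:E) ^+ n)%E.
Proof.
move=> mg g0.
have g0' m (x : Rd R m) : (0 <= (\prod_(i < m) g (tnth x i))%:E)%E.
  by rewrite lee_fin; apply: prodr_ge0.
have mprod m : measurable_fun setT
    (fun x : Rd R m => (\prod_(i < m) g (tnth x i))%:E).
  apply/measurable_EFinP; apply: measurable_prod => i _.
  by apply: measurableT_comp => //; exact: measurable_tnth.
elim: n => [|n IH].
  rewrite /= integral_dirac//=; last exact: mprod.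
  by rewrite big_ord0 mule1 diracE mem_set.
rewrite ge0_integral_cons// expeS.
transitivity (\int[lebesgue_measure]_a
    ((g a)%:E * (\int[lebesgue_measure]_t (g t)%:E) ^+ n))%E.
  apply: eq_integral => a _; rewrite -IH -ge0_integralZl//=.
  - apply: eq_integral => x _; rewrite big_ord_recl tnth0 EFinM.
    congr (_ * _%:E)%E; apply: eq_bigr => i _; congr g; exact: tnthS.
  - exact: mprod.
  - by move=> x _; exact: g0'.
  - by rewrite lee_fin.
rewrite ge0_integralZr//; first exact/measurable_EFinP.
  by move=> t _; rewrite lee_fin.
by apply: expe_ge0; apply: integral_ge0 => t _; rewrite lee_fin.
Qed.

(** * Integrability of |y|^(-r) at infinity for r > d *)

Lemma cvg_powR_tail (R : realType) (e : R) : 0 < e ->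
  (1 + t) `^ (- e) @[t --> +oo] --> (0 : R).
Proof.
move=> e0; apply: (@cvg_trans _ (expR (- (e * ln (1 + t))) @[t --> +oo])).
  apply: near_eq_cvg; near=> t.
  by rewrite /powR gt_eqF ?mulNr// ltr_wpDr.
apply: (@cvg_comp _ _ _ (fun t : R => e * ln (1 + t)) (fun x => expR (- x)) _
  (@pinfty_nbhs R)); last exact: cvgr_expR.
apply/cvgryPge => A; near=> t.
have t0 : 0 <= t by near: t; apply: nbhs_pinfty_ge; rewrite num_real.
have tA : expR (A / e) <= t by near: t; apply: nbhs_pinfty_ge; rewrite num_real.
rewrite mulrC -ler_pdivrMr// -(expRK (A / e)) ler_ln ?posrE ?expR_gt0//.
  by rewrite (le_trans tA)// lerDr.
by rewrite ltr_wpDr.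
Unshelve. all: by end_near. Qed.

Lemma is_derive_powR_shift (R : realType) (r x : R) : -1 < x ->
  is_derive x 1 (fun t : R => (1 + t) `^ r) (r * (1 + x) `^ (r - 1)).
Proof.
move=> x0.
have x1 : 0 < 1 + x by rewrite addrC -ltrBlDr sub0r.
have d1 : is_derive x 1 (fun t : R => 1 + t) 1.
  rewrite (_ : (fun t : R => 1 + t) = shift 1); first exact: is_derive_shift.
  by apply/funext => t; rewrite /= addrC.
by have := is_derive1_comp (is_derive1_powR r x1) d1; rewrite mulr1.
Qed.

(** The integrand is even, and - (1 + t)^(-e) / e is a primitive of it on the
    half-line that vanishes at infinity. *)
Lemma integral_1Dnorm_powRN_lty (R : realType) (e : R) : 0 < e ->
  (\int[lebesgue_measure]_t ((1 + `|t : R|) `^ (- (1 + e)))%:E < +oo)%E.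
Proof.
move=> e0.
have cf : continuous (fun t : R => (1 + `|t|) `^ (- (1 + e))).
  move=> t; apply: (@continuous_comp _ _ _ (fun t : R => 1 + `|t|)
    (fun y => y `^ (- (1 + e)))).
    by apply: cvgD; [exact: cvg_cst|exact: norm_continuous].
  apply/differentiable_continuous/derivable1_diffP/derivable_powR.
  by rewrite in_itv/= andbT ltr_pwDl.
rewrite ge0_symfun_integralT//; last by move=> t /=; rewrite normrN.
pose F (t : R) : R := - e^-1 * (1 + t) `^ (- e).
have dF (x : R) : 0 <= x -> is_derive x 1 F ((1 + `|x|) `^ (- (1 + e))).
  move=> x0; rewrite ger0_norm// opprD [- 1 - e]addrC.
  have dx := @is_derive_powR_shift R (- e) x (lt_le_trans (ltrN10 R) x0).
  have := @is_deriveZ _ _ _ _ (- e^-1) _ _ _ dx.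
  by rewrite scalerA mulNr mulrN opprK mulVf ?gt_eqF// scale1r.
rewrite -set_itvcy (@ge0_continuous_FTC2y _ _ F 0 0)//.
- by rewrite -EFinB -EFinM ltry.
- exact: continuous_subspaceT.
- rewrite -(mulr0 (- e^-1)); apply: cvgMl_tmp; exact: cvg_powR_tail.
- by move=> x x0; have [] := dF x (ltW x0).
- apply: cvg_at_right_filter; apply/differentiable_continuous/derivable1_diffP.
  by have [] := dF 0 (lexx 0).
- move=> x; rewrite in_itv/= andbT => x0.
  by rewrite derive1E; have [_ ->] := dF x (ltW x0).
Qed.

Lemma enorm_ge0 (R : realType) (n : nat) (x : Rd R n) : 0 <= enorm x.
Proof. exact: sqrtr_ge0. Qed.

Lemma le_enorm (R : realType) (n : nat) (x : Rd R n) (i : 'I_n) :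
  `|tnth x i| <= enorm x.
Proof.
rewrite /enorm -sqrtr_sqr ler_wsqrtr// (bigD1 i)//= lerDl.
by apply: sumr_ge0 => j _; exact: sqr_ge0.
Qed.

Lemma measurable_enorm (R : realType) (n : nat) :
  measurable_fun setT (fun x : Rd R n => enorm x).
Proof.
rewrite (_ : (fun _ => _) =
    (fun x : Rd R n => (\sum_(i < n) tnth x i ^+ 2) `^ 2^-1)); last first.
  by apply/funext => x; rewrite powR12_sqrt// sumr_ge0// => i _; exact: sqr_ge0.
apply: (measurableT_comp (measurable_powR _ )).
apply: measurable_sum => i; apply: measurable_funX; exact: measurable_tnth.
Qed.

(** Each coordinate contributes a factor: 1 + |x_i| <= 2 |x| because both 1 and
    |x_i| are at most |x|. *)
Lemma enorm_powR_le (R : realType) (n : nat) (p : R) (x : Rd R n) :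
  0 <= p -> 1 < enorm x ->
  (enorm x `^ (n%:R * p))^-1 <=
  2 `^ (n%:R * p) * \prod_(i < n) (1 + `|tnth x i|) `^ (- p).
Proof.
move=> p0 x1; have x0 : 0 < enorm x := lt_trans ltr01 x1.
have -> : 2 `^ (n%:R * p) * \prod_(i < n) (1 + `|tnth x i|) `^ (- p) =
    \prod_(i < n) (2 `^ p * (1 + `|tnth x i|) `^ (- p)).
  by rewrite big_split/= prodr_const card_ord -powR_mulrn ?powR_ge0// -powRrM [p * _]mulrC.
have -> : (enorm x `^ (n%:R * p))^-1 = \prod_(i < n) enorm x `^ (- p).
  rewrite prodr_const card_ord -powR_mulrn ?powR_ge0// -powRrM -powRN.
  by congr (_ `^ _); ring.
apply: ler_prod => i _.
have i0 : 0 < 1 + `|tnth x i| by rewrite ltr_pwDl.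
rewrite powR_ge0/= !powRN ler_pdivlMr ?powR_gt0//.
rewrite ler_pdivrMl ?powR_gt0// -powRM// ?enorm_ge0//.
apply: ge0_ler_powR => //; rewrite ?nnegrE ?addr_ge0 ?mulr_ge0 ?enorm_ge0//.
have := le_enorm R n x i; lra.
Qed.

Lemma integral_enorm_tail_lty (R : realType) (n : nat) (r : R) :
  (0 < n)%N -> n%:R < r ->
  (\int[lebesgueRd R n]_(y in [set y | (1 < enorm y)%R]) (enorm y `^ r)^-1%:E < +oo)%E.
Proof.
move=> n0 nr; have n0' : 0 < n%:R :> R by rewrite ltr0n.
have -> : r = n%:R * (r / n%:R) by rewrite mulrCA divff ?mulr1// gt_eqF.
(* Share the decay equally among the n coordinates. *)
set p := r / n%:R.
have p1 : 1 < p by rewrite /p ltr_pdivlMr// mul1r.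
have p0 : 0 <= p by rewrite (le_trans ler01) ?ltW.
pose w (y : Rd R n) := 2 `^ (n%:R * p) * \prod_(i < n) (1 + `|tnth y i|) `^ (- p).
have mg : measurable_fun setT (fun t : R => (1 + `|t|) `^ (- p)).
  apply: (measurableT_comp (measurable_powR _)).
  by apply: measurable_funD => //; exact: normr_measurable.
have w0 y : 0 <= w y.
  by rewrite mulr_ge0 ?powR_ge0// prodr_ge0// => i _; exact: powR_ge0.
rewrite integral_mkcond.
apply: (@le_lt_trans _ _ (\int[lebesgueRd R n]_y (w y)%:E)%E).
  apply: ge0_le_integral_pointwise => y.
    by apply: erestrict_ge0 => z _; rewrite lee_fin invr_ge0 powR_ge0.
  rewrite patchE; case: ifPn => [|_]; last by rewrite lee_fin.
  by rewrite inE/= => y1; rewrite lee_fin enorm_powR_le.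
under eq_integral do rewrite EFinM.
rewrite ge0_integralZl//=; last 2 first.
- apply/measurable_EFinP; apply: measurable_prod => i _.
  exact: measurableT_comp mg (measurable_tnth i).
- by move=> y _; rewrite lee_fin prodr_ge0// => i _; exact: powR_ge0.
rewrite (integral_prod_tnth R n (fun t => (1 + `|t|) `^ (- p)))//.
have := integral_1Dnorm_powRN_lty R (p - 1); rewrite subr_gt0 => /(_ p1).
rewrite addrC subrK; set I := (X in (X < +oo)%E) => Ioo.
have I0 : (0 <= I)%E by apply: integral_ge0 => t _; rewrite lee_fin powR_ge0.
have Inoo : (I ^+ n < +oo)%E.
  by rewrite -ge0_fin_numE ?expe_ge0// fin_numX// ge0_fin_numE.
by apply: lte_mul_pinfty => //; rewrite lee_fin powR_ge0.
Qed.

(** * Comparison of the Gagliardo and jump-kernel energies *)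

Lemma L2normE (R : realType) (n : nat) (u : Rd R n -> R) :
  L2norm u = sqrte (\int[lebesgueRd R n]_x (u x ^+ 2)%:E)%E.
Proof.
have u20 : (0 <= \int[lebesgueRd R n]_x (u x ^+ 2)%:E)%E.
  by apply: integral_ge0 => x _; rewrite lee_fin sqr_ge0.
rewrite -poweR12_sqrt// -[LHS]poweRe1 ?Lnorm_ge0//.
rewrite -[X in (_ `^ X)%E](@mulfV _ (2 : R))// poweRrM /L2norm powR_Lnorm//.
congr (_ `^ _)%E; apply: eq_integral => x _ /=.
by rewrite powR_mulrn// -normrX ger0_norm ?sqr_ge0.
Qed.

(** From (a - b)^2 <= 2 a^2 + 2 b^2, where by translation invariance both squares
    have the same integral. *)
Lemma integral_sqr_diff_le (R : realType) (n : nat) (u : Rd R n -> R)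
    (h : Rd R n) : measurable_fun setT u ->
  (\int[lebesgueRd R n]_x (`|u (addRd x h) - u x| ^+ 2)%:E <=
   4%:E * \int[lebesgueRd R n]_x (u x ^+ 2)%:E)%E.
Proof.
move=> mu.
have mu2 : measurable_fun setT (fun x => (u x ^+ 2)%:E).
  by apply/measurable_EFinP; exact: measurable_funX.
have mu2h : measurable_fun setT (fun x => (u (addRd x h) ^+ 2)%:E).
  exact: (measurableT_comp mu2 (@measurable_addRdl _ _ h)).
have u20 x : (0 <= (u x ^+ 2)%:E)%E by rewrite lee_fin sqr_ge0.
apply: (@le_trans _ _ (\int[lebesgueRd R n]_x
    (2%:E * ((u (addRd x h) ^+ 2)%:E + (u x ^+ 2)%:E)))%E).
  apply: ge0_le_integral_pointwise => x; first by rewrite lee_fin exprn_ge0.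
  rewrite -EFinD -EFinM lee_fin real_normK ?num_real//.
  by rewrite -subr_ge0; set a := u _; set b := u _;
    rewrite (_ : _ - _ = (a + b) ^+ 2); [exact: sqr_ge0|ring].
rewrite ge0_integralZl//=; last 2 first.
- exact: emeasurable_funD.
- by move=> x _; apply: adde_ge0.
rewrite ge0_integralD//= (ge0_integral_addRd R n h (fun x => (u x ^+ 2)%:E))//.
set I := (\int[_]_x _)%E.
have I0 : (0 <= I)%E by apply: integral_ge0.
by rewrite -mule2n -mule_natl muleA -EFinM -natrM.
Qed.

Lemma measurable_diff_quotient (R : realType) (n : nat) (r : R)
    (u : Rd R n -> R) : measurable_fun setT u ->
  measurable_fun setT (fun p : Rd R n * Rd R n =>
    (`|u (addRd p.1 p.2) - u p.1| ^+ 2 / enorm p.2 `^ r)%:E).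
Proof.
move=> mu; apply/measurable_EFinP/measurable_funM.
  apply/measurable_funX/measurableT_comp => //.
  apply: measurable_funB; last exact: measurableT_comp mu measurable_fst.
  exact: measurableT_comp mu (@measurable_addRd R n).
under eq_fun do rewrite -powRN.
apply: (measurableT_comp (measurable_powR _)).
exact: measurableT_comp (@measurable_enorm R n) measurable_snd.
Qed.

(** The splitting of the Gagliardo integral at |y| = 1. The first summand on the
    right bounds the short increments, the second one the long increments. *)
Lemma gagliardo_le (R : realType) (n : nat) (r c : R) (j : R -> \bar R)
    (u : Rd R n -> R) :
  r != 0 -> 0 < c -> measurable_fun setT u ->
  (forall t, 0 <= j t)%E ->
  (forall t, 0 < t -> t <= 1 -> ((c * t `^ (- r))%:E <= j t)%E) ->
  (\int[lebesgueRd R n]_x \int[lebesgueRd R n]_y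
     (`|u (addRd x y) - u x| ^+ 2 / enorm y `^ r)%:E <=
   c^-1%:E * (\int[lebesgueRd R n]_h \int[lebesgueRd R n]_x
     ((`|u (addRd x h) - u x| ^+ 2)%:E * j (enorm h))) +
   (\int[lebesgueRd R n]_(y in [set y | (1 < enorm y)%R])
      (enorm y `^ r)^-1%:E) *
   (4%:E * \int[lebesgueRd R n]_x (u x ^+ 2)%:E))%E.
Proof.
move=> r0 c0 mu j0 jc.
have mg := measurable_diff_quotient R n r u mu.
have g0 (p : Rd R n * Rd R n) :
    (0 <= (`|u (addRd p.1 p.2) - u p.1| ^+ 2 / enorm p.2 `^ r)%:E)%E.
  by rewrite lee_fin divr_ge0 ?exprn_ge0 ?powR_ge0.
have E0 : (0 <= \int[lebesgueRd R n]_x (u x ^+ 2)%:E)%E.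
  by apply: integral_ge0 => x _; rewrite lee_fin sqr_ge0.
rewrite (fubini_tonelli _ mg g0)/=.
pose G (y : Rd R n) := (\int[lebesgueRd R n]_x
  (`|u (addRd x y) - u x| ^+ 2 / enorm y `^ r)%:E)%E.
have mG : measurable_fun setT G.
  exact: (measurable_fun_fubini_tonelli_G (m1 := lebesgueRd R n) _ mg g0).
have G0 y : (0 <= G y)%E by apply: integral_ge0 => x _; exact: (g0 (x, y)).
pose D := [set y : Rd R n | 1 < enorm y].
have mD : measurable D.
  rewrite -[D]setTI (_ : D = (fun y => enorm y) @^-1` `]1, +oo[%classic).
    by apply: measurable_enorm => //; exact: measurable_itv.
  by apply/seteqP; split => y /=; rewrite in_itv/= andbT.
have -> : (\int[lebesgueRd R n]_y \int[lebesgueRd R n]_x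
    (`|u (addRd x y) - u x| ^+ 2 / enorm y `^ r)%:E =
    \int[lebesgueRd R n]_(y in D) G y + \int[lebesgueRd R n]_(y in ~` D) G y)%E.
  rewrite -ge0_integral_setU ?setUv//=; first exact: measurableC.
  exact/disj_setPCl.
(* The complement of D, the short increments, comes first on the right. *)
rewrite addeC; apply: leeD.
  rewrite lee_pdivlMl// -ge0_integralZl//=; last 3 first.
  - exact: measurableC.
  - exact: measurable_funTS.
  - by rewrite lee_fin ltW.
  rewrite integral_mkcond; apply: ge0_le_integral_pointwise => y.
    by apply: erestrict_ge0 => z _; rewrite mule_ge0// lee_fin ltW.
  rewrite patchE; case: ifPn => [|_]; last first.
    by apply: integral_ge0 => x _; rewrite mule_ge0// lee_fin exprn_ge0.
  rewrite inE/= /D/= => /negP; rewrite -leNgt => y1.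
  rewrite -ge0_integralZl//=; last 3 first.
  - exact: measurableT_comp mg (measurable_pair2 y).
  - by move=> x _; exact: (g0 (x, y)).
  - by rewrite lee_fin ltW.
  apply: ge0_le_integral_pointwise => x.
    by rewrite mule_ge0 ?lee_fin ?(ltW c0)//; exact: (g0 (x, y)).
  (* The kernel bound says nothing at y = 0, but there the quotient is 0
     because inversion sends 0 to 0. *)
  have [y0|y0] := eqVneq (enorm y) 0.
    rewrite y0 powR0// invr0 mulr0 mule0; exact: mule_ge0.
  rewrite -EFinM mulrCA EFinM -powRN; apply: lee_pmul => //.
  - by rewrite lee_fin mulr_ge0 ?powR_ge0 ?ltW.
  - by apply: jc => //; rewrite lt_neqAle eq_sym y0 enorm_ge0.
rewrite -ge0_integralZr//=; last 3 first.
- apply: measurable_funTS; apply/measurable_EFinP.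
  under eq_fun do rewrite -powRN.
  exact: measurableT_comp (measurable_powR _) (@measurable_enorm R n).
- by move=> y _; rewrite lee_fin invr_ge0 powR_ge0.
- by rewrite mule_ge0.
rewrite integral_mkcond [leRHS]integral_mkcond.
apply: ge0_le_integral_pointwise => y; first by apply: erestrict_ge0.
apply: lee_restrict => z _; rewrite /G.
under eq_integral do rewrite EFinM.
rewrite ge0_integralZr//=; last 2 first.
- apply/measurable_EFinP/measurable_funX/measurableT_comp => //.
  apply: measurable_funB => //.
  exact: measurableT_comp mu (@measurable_addRdl R n z).
- by rewrite lee_fin invr_ge0 powR_ge0.
rewrite muleC lee_wpmul2l//; last exact: integral_sqr_diff_le.
by rewrite lee_fin invr_ge0 powR_ge0.
Qed.

Lemma jump_kernel_ge0 (R : realType) (d : nat) (m : R -> R) (r : R) :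
  completely_monotone m -> (0 <= jump_kernel d m r)%E.
Proof.
move=> [_ m_cm]; apply: integral_ge0 => t /=; rewrite in_itv/= andbT => t0.
have := m_cm 0%N t t0; rewrite expr0 mul1r /= => mt0.
by rewrite lee_fin !mulr_ge0 ?powR_ge0 ?expR_ge0.
Qed.

Lemma sqrte_le_lincomb (R : realType) (a b k l B : \bar R) :
  (0 <= a -> 0 <= b -> 0 <= k -> 0 <= l ->
   B <= k * a + l * b ->
   sqrte B <= sqrte k * sqrte a + sqrte l * sqrte b)%E.
Proof.
move=> a0 b0 k0 l0 Bab; rewrite -!sqrteM//.
have x0 := mule_ge0 k0 a0; have y0 := mule_ge0 l0 b0.
move: (k * a)%E (l * b)%E x0 y0 Bab => x y x0 y0 Bxy.
have xy0 := adde_ge0 x0 y0.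
apply: (@le_trans _ _ (sqrte (x + y))); first by rewrite lee_sqrt.
move: x y x0 y0 {Bxy xy0} => [x| |] [y| |]//= x0 y0.
rewrite -EFinD lee_fin -(@ler_pXn2r _ 2)// ?nnegrE ?addr_ge0 ?sqrtr_ge0//.
rewrite sqrrD !sqr_sqrtr ?addr_ge0// -lerBlDr.
have : 0 <= Num.sqrt x * Num.sqrt y *+ 2 by rewrite mulrn_wge0// mulr_ge0 ?sqrtr_ge0.
by move: (_ *+ 2) => z z0; lra.
Qed.

Theorem proposition2p2 (R : realType) (d : nat) (hd : (0 < d)%N)
    (s c : R) (hs0 : 0 < s) (hs1 : s < 1) (hc : 0 < c) :
  exists C : R, 0 < C /\
  forall Phi m : R -> R,
    complete_bernstein0 Phi m ->
    (forall t : R, 0 < t ->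
      (\int[lebesgueRd R d]_xi (expR (- (t * Phi (enorm xi ^+ 2))))%:E
        < +oo)%E) ->
    (forall r : R, 0 < r -> r <= 1 ->
      ((c * r `^ (- d%:R - 2 * s))%:E <= jump_kernel d m r)%E) ->
    forall u : Rd R d -> R, in_HPhi m u ->
      in_Hs s u /\
      (L2norm u + seminorm_s s u <= C%:E * (L2norm u + seminorm_Phi m u))%E.
Proof.
pose r : R := d%:R + 2 * s.
have dr : d%:R < r by rewrite /r ltrDl mulr_gt0.
have r0 : r != 0 by rewrite gt_eqF// (le_lt_trans _ dr).
have Koo := integral_enorm_tail_lty R d r hd dr.
set K := (X in (X < +oo)%E) in Koo.
have K0 : (0 <= K)%E.
  by apply: integral_ge0 => y _; rewrite lee_fin invr_ge0 powR_ge0.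
have Kfin : (fine K)%:E = K by rewrite fineK// ge0_fin_numE.
have k0 : 0 <= fine K by exact: fine_ge0.
(* The 1 pays for the L^2 norm on the left-hand side. *)
exists (1 + Num.sqrt (2 / c) + Num.sqrt (4 * fine K)); split.
  by rewrite ltr_wpDr ?sqrtr_ge0// ltr_wpDr ?sqrtr_ge0.
move=> Phi m [_ [mu [_ _ m_cm]]] _ jc u [uL2 uPhi].
have mu_u : measurable_fun setT u by have /andP[] := uL2; rewrite inE.
have j0 t : (0 <= jump_kernel d m t)%E by exact: jump_kernel_ge0.
have jc' t : 0 < t -> t <= 1 -> ((c * t `^ (- r))%:E <= jump_kernel d m t)%E.
  by rewrite /r opprD; exact: jc.
have key := gagliardo_le R d r c (jump_kernel d m) u r0 hc mu_u j0 jc'.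
have Loo : (L2norm u < +oo)%E.
  by have /andP[_] := uL2; rewrite inE.
rewrite -/K -Kfin in key.
move: uPhi; rewrite /seminorm_Phi.
set A := (\int[_]_h \int[_]_x (_ * jump_kernel d m _))%E in key *.
set E := (\int[_]_x (u x ^+ 2)%:E)%E in key.
have A0 : (0 <= A)%E.
  apply: integral_ge0 => h _; apply: integral_ge0 => x _.
  by rewrite mule_ge0// lee_fin exprn_ge0.
have E0 : (0 <= E)%E.
  by apply: integral_ge0 => x _; rewrite lee_fin sqr_ge0.
have hA0 : (0 <= 2^-1%:E * A)%E by rewrite mule_ge0// lee_fin.
set Q := sqrte _ => Qoo.
have semi_le : (seminorm_s s u <=
    (Num.sqrt (2 / c))%:E * Q + (Num.sqrt (4 * fine K))%:E * L2norm u)%E.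
  rewrite L2normE -/E /Q.
  apply: (@sqrte_le_lincomb _ _ _ (2 / c)%:E (4 * fine K)%:E) => //.
  - by rewrite lee_fin divr_ge0// ltW.
  - by rewrite lee_fin mulr_ge0.
  (* The 2 compensates the factor 1/2 in the Phi-seminorm. *)
  - rewrite muleA -EFinM mulrAC divff// mul1r [4 * _]mulrC EFinM -muleA.
    exact: key.
have Q0 : (0 <= Q)%E by exact: sqrte_ge0.
have L0 : (0 <= L2norm u)%E by exact: Lnorm_ge0.
split.
  split => //; apply: (le_lt_trans semi_le).
  by rewrite lte_add_pinfty// lte_mul_pinfty// lee_fin sqrtr_ge0.
apply: (@le_trans _ _ _ _ _ (leeD2l _ semi_le)).
have Qfin : Q \is a fin_num by rewrite ge0_fin_numE.
have Lfin : L2norm u \is a fin_num by rewrite ge0_fin_numE.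
rewrite -(fineK Qfin) -(fineK Lfin) -!EFinM -!EFinD lee_fin.
have q0 := fine_ge0 Q0; have l0 := fine_ge0 L0.
have a0 : 0 <= Num.sqrt (2 / c) by exact: sqrtr_ge0.
have b0 : 0 <= Num.sqrt (4 * fine K) by exact: sqrtr_ge0.
nra.
Qed.
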